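(* Let $X(x)$ be a bounded and integrable $n\times n$ matrix function on $[0,b]$. Then for every $x\in[0,b]$: 1. the series $\mathcal{E}[X](x)$ and $\mathcal{F}[X](x)$ converge; 2. $$\det\mathcal{E}[X](x)=\det\mathcal{F}[X](x)=\det e^{\int_0^xX(t)\,dt}=e^{\int_0^x\operatorname{tr}X(t)\,dt}=e^{\operatorname{tr}\int_0^xX(t)\,dt};$$ 3. $\mathcal{E}[X](x)$ and $\mathcal{F}[X](x)$ are invertible matrices, and $$\mathcal{F}[X](x)\,\mathcal{E}[-X](x)=\mathcal{E}[-X](x)\,\mathcal{F}[X](x)=I.$$
   Context: Scalars are in a fixed field $\mathbb{K}=\mathbb{R}$ or $\mathbb{C}$. A matrix function is bounded and integrable on $[0,b]$ if all its entries are bounded and (Lebesgue) integrable on $[0,b]$. For a square matrix function $X$ on $[0,b]$ define the integral series $$\mathcal{E}[X](x)=I+\int_0^x X(t)\,dt+\int_0^x X(t)\int_0^t X(s)\,ds\,dt+\int_0^x X(t)\int_0^t X(s)\int_0^s X(\xi)\,d\xi\,ds\,dt+\cdots,$$ $$\mathcal{F}[X](x)=I+\int_0^x X(t)\,dt+\int_0^x\Big(\int_0^t X(s)\,ds\Big)X(t)\,dt+\int_0^x\Big(\int_0^t\Big(\int_0^s X(\xi)\,d\xi\Big) X(s)\,ds\Big)X(t)\,dt+\cdots,$$ i.e. $\mathcal{E}[X]=\sum_{k\ge0}E_k$ and $\mathcal{F}[X]=\sum_{k\ge0}F_k$ with $E_0=F_0=I$, $E_{k+1}(x)=\int_0^xX(t)E_k(t)\,dt$,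 $F_{k+1}(x)=\int_0^xF_k(t)X(t)\,dt$. *)

(* Defs.v *)
From HB Require Import structures.
From mathcomp Require Import all_boot all_order all_algebra.
From mathcomp Require Import all_classical all_reals all_analysis.
From mathcomp Require Import complex.

Set Implicit Arguments.
Unset Strict Implicit.
Unset Printing Implicit Defensive.

Import Order.TTheory GRing.Theory Num.Theory.
Import numFieldNormedType.Exports.

Local Open Scope classical_set_scope.
Local Open Scope ring_scope.

(* The scalar field is K = R or K = C = R[i]; in both cases the topology, norm
   and boundedness are the ones MathComp-Analysis attaches to a numFieldType. *)
Inductive scalars := RealScalars | ComplexScalars.

Definition scalar_field (R : realType) (s : scalars) : numFieldType :=
  match s with
  | RealScalars => R
  | ComplexScalars => R[i]
  end.

(* The completed measure is used because its measurable sets are the Lebesgue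
   measurable ones; lebesgue_measure lives on the Borel sets only.
   A complex function is integrated through its real and imaginary parts. *)
Definition scalar_integrable (R : realType) (s : scalars) (D : set R) :
    (R -> scalar_field R s) -> Prop :=
  match s with
  | RealScalars => fun f : R -> R =>
      (@completed_lebesgue_measure R).-integrable D (EFin \o f)
  | ComplexScalars => fun f : R -> R[i] =>
      (@completed_lebesgue_measure R).-integrable D
        (fun t => (complex.Re (f t))%:E) /\
      (@completed_lebesgue_measure R).-integrable D
        (fun t => (complex.Im (f t))%:E)
  end.

Definition scalar_integral (R : realType) (s : scalars) (D : set R) :
    (R -> scalar_field R s) -> scalar_field R s :=
  match s with
  | RealScalars => fun f : R -> R =>
      Rintegral (@completed_lebesgue_measure R) D f
  | ComplexScalars => fun f : R -> R[i] =>
      Complex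
        (Rintegral (@completed_lebesgue_measure R) D
           (fun t => complex.Re (f t)))
        (Rintegral (@completed_lebesgue_measure R) D
           (fun t => complex.Im (f t)))
  end.

Section MatrixFunctions.
Context {R : realType} {s : scalars} {n : nat}.
Local Notation K := (scalar_field R s).
Implicit Types X G : R -> 'M[K]_n.

Definition mx_bounded_on (D : set R) X : Prop :=
  forall i j, [bounded X t i j | t in D].

Definition mx_integrable_on (D : set R) X : Prop :=
  forall i j, scalar_integrable D (fun t => X t i j).

Definition mx_integral (D : set R) G : 'M[K]_n :=
  \matrix_(i, j) scalar_integral D (fun t => G t i j).

Fixpoint E_term X (k : nat) : R -> 'M[K]_n :=
  match k with
  | 0%N => fun=> 1%:M
  | k'.+1 => fun x => mx_integral `[0, x] (fun t => X t *m E_term X k' t)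
  end.

Fixpoint F_term X (k : nat) : R -> 'M[K]_n :=
  match k with
  | 0%N => fun=> 1%:M
  | k'.+1 => fun x => mx_integral `[0, x] (fun t => F_term X k' t *m X t)
  end.

Definition E_partial X (x : R) : ('M[K]_n)^nat :=
  series (fun k => E_term X k x).

Definition F_partial X (x : R) : ('M[K]_n)^nat :=
  series (fun k => F_term X k x).

Definition E_series X (x : R) : 'M[K]_n := limn (E_partial X x).

Definition F_series X (x : R) : 'M[K]_n := limn (F_partial X x).

Definition mx_exp (A : 'M[K]_n) : 'M[K]_n :=
  limn (series (fun k => (k`!%:R)^-1 *: A ^+ k)).

End MatrixFunctions.

Definition scalar_exp (R : realType) (s : scalars) (z : scalar_field R s) :
    scalar_field R s :=
  limn (series (fun k => z ^+ k / k`!%:R)).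

Lemma scalar_expR (R : realType) (x : R) :
  @scalar_exp R RealScalars x = expR x.
Proof. by []. Qed.

(* Main.v *)
Require Import Defs.
From HB Require Import structures.
From mathcomp Require Import all_boot all_order all_algebra.
From mathcomp Require Import all_classical all_reals all_analysis.
From mathcomp Require Import perm complex measurable_realfun ring.

(** The entries of X are only bounded and measurable, so its integral series
    are Lipschitz but need not be differentiable at any given point. The whole
    argument therefore runs on an integrated form of differentiation: F is a
    primitive of f on [0, b] when both are bounded and measurable and
    F x = F 0 + \int_0^x f. This relation obeys the product rule
    ([primitiveM]), i.e. integration by parts. The reason is elementary: the
    increment over [x, y] of the difference between the two sides is
    O((y - x)^2), and a function with quadratic increments is constant
    ([quadratic_increments_constant]).

    The term E_k is bounded by (c x)^k / k!, where c depends on n and on a bound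
    of X ([E_term_le]). Hence E[X] converges uniformly on [0, b], and passing to
    the limit in the recursion gives that X E[X] is the derivative of E[X]
    ([E_series_primitive]). Transposing a matrix product reverses it, so that
    F[X] is the transpose of E[X^T], and F[X] X is the derivative of F[X].

    The rest is algebra with derivatives. If G' = - X G then
    (F[X] G)' = F[X] X G - F[X] X G = 0, so F[X] G keeps its initial value. For
    G = E[-X] this is the inverse formula, and it makes the solution of
    G' = X G with G 0 = 1 unique ([E_series_unique]).

    For the determinant, the product rule applied to the Leibniz expansion is
    Jacobi's formula (det F)' = tr (F' adj F) ([det_primitive]), which for
    E[X]' = X E[X] becomes (det E[X])' = tr X det E[X]. So det E[X] solves the
    1 x 1 equation with coefficient tr X, and by uniqueness it is the integral
    series of tr X, whose terms are (\int_0^x tr X)^k / k!: it is the exponential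
    of \int_0^x tr X ([det_E_series]). The matrix exponential of A is itself
    E[A] at 1 for the constant function A ([mx_exp_E_series]), so its
    determinant comes from the same formula. *)

Set Implicit Arguments.
Unset Strict Implicit.
Unset Printing Implicit Defensive.

Import Order.TTheory GRing.Theory Num.Theory.
Import numFieldNormedType.Exports.

Local Open Scope classical_set_scope.
Local Open Scope ring_scope.

(* The real line with the sigma-algebra of Lebesgue measurable sets, on which
   the completed Lebesgue measure is defined. *)
Local Notation completed_line R := (caratheodory_type
  (R:=R) (T:=ocitv_type R) (wlength idfun)^*%mu).

(** * Lebesgue measurable functions on an interval *)

Section RealCalculus.
Context {R : realType}.
Local Notation mu := (@completed_lebesgue_measure R).

Implicit Types (b x y t : R) (f g : R -> R).

Lemma borel_completed (A : set R) :
  measurable A -> measurable (A : set (completed_line R)).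
Proof. by move=> mA; apply: sub_caratheodory; exact: mA. Qed.

Lemma itv_completed (i : interval R) : measurable ([set` i] : set (completed_line R)).
Proof. by apply: borel_completed; exact: measurable_itv. Qed.

(** The Lebesgue measure on the Borel sets and the completed one restrict the
    same outer measure. *)
Lemma completed_measure_itv (i : interval R) :
  mu [set` i] = (if i.1 < i.2 then (i.2 : \bar R) - i.1 else 0)%E.
Proof. by rewrite -lebesgue_measure_itv. Qed.

Lemma continuous_on_completed (a b : R) (f : R -> R) :
  {within `[a, b], continuous f} ->
  measurable_fun (`[a, b] : set (completed_line R)) (f : completed_line R -> R).
Proof.
move=> cf mD Y mY; apply: borel_completed.
by apply: (subspace_continuous_measurable_fun _ cf) => //; exact: measurable_itv.
Qed.

(** The class of functions that the argument never leaves: on a bounded interval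
    it consists of integrable functions, and it is closed under products. *)
Definition bounded_measurable (b : R) (f : R -> R) :=
  measurable_fun (`[0, b] : set (completed_line R)) (f : completed_line R -> R) /\
  exists M, forall t, 0 <= t <= b -> `|f t| <= M.

Lemma bounded_measurable_integrable b f (D : set (completed_line R)) :
  bounded_measurable b f -> measurable D -> D `<=` `[0, b] ->
  mu.-integrable D (EFin \o f).
Proof.
move=> [mf [M fM]] mD Db.
have mI := itv_completed `[0, b].
apply: measurable_bounded_integrable => //.
- apply: (@le_lt_trans _ _ (mu `[0, b])).
    by apply: le_measure => //; rewrite inE.
  by rewrite completed_measure_itv /=; case: ifPn => // _; rewrite -EFinB ltry.
- exact: measurable_funS mf.
- exists M; split; first exact: num_real.
  move=> r Mr t /Db; rewrite /= in_itv /= => /fM /le_trans; apply.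
  exact: ltW.
Qed.

Lemma bounded_measurable_cst b (c : R) : bounded_measurable b (fun=> c).
Proof. by split; [exact: measurable_cst | exists `|c|]. Qed.

Lemma bounded_measurableD b f g :
  bounded_measurable b f -> bounded_measurable b g ->
  bounded_measurable b (fun t => f t + g t).
Proof.
move=> [mf [M fM]] [mg [N gN]]; split; first exact: measurable_funD.
exists (M + N) => t tb.
by rewrite (le_trans (ler_normD _ _)) // lerD ?fM ?gN.
Qed.

Lemma bounded_measurableM b f g :
  bounded_measurable b f -> bounded_measurable b g ->
  bounded_measurable b (fun t => f t * g t).
Proof.
move=> [mf [M fM]] [mg [N gN]]; split; first exact: measurable_funM.
by exists (M * N) => t tb; rewrite normrM ler_pM ?fM ?gN.
Qed.

Lemma bounded_measurableZ b c f :
  bounded_measurable b f -> bounded_measurable b (fun t => c * f t).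
Proof.
by move=> bf; apply: bounded_measurableM => //; exact: bounded_measurable_cst.
Qed.

Lemma bounded_measurableN b f :
  bounded_measurable b f -> bounded_measurable b (fun t => - f t).
Proof.
move=> [mf [M fM]]; split; first exact: measurable_funN.
by exists M => t tb; rewrite normrN fM.
Qed.

Lemma bounded_measurableB b f g :
  bounded_measurable b f -> bounded_measurable b g ->
  bounded_measurable b (fun t => f t - g t).
Proof. by move=> bf bg; apply/bounded_measurableD/bounded_measurableN. Qed.

Lemma Rintegral_le_cst b f (D : set (completed_line R)) c :
  bounded_measurable b f -> measurable D -> D `<=` `[0, b] ->
  (forall t, D t -> `|f t| <= c) ->
  `|Rintegral mu D f| <= c * fine (mu D).
Proof.
move=> bf mD Db fc; rewrite -Rintegral_cst //.
have fi := bounded_measurable_integrable bf mD Db.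
have ci := bounded_measurable_integrable (bounded_measurable_cst b c) mD Db.
apply: (le_trans (le_normr_Rintegral mD fi)).
by apply: le_Rintegral => //; exact: integrable_norm.
Qed.

Definition running_integral (f : R -> R) (x : R) := Rintegral mu `[0, x] f.

Lemma subset_itvoc0 (x y b : R) : 0 <= x -> y <= b ->
  `]x, y]%classic `<=` `[0, b]%classic.
Proof.
move=> x0 yb t; rewrite /= !in_itv /= => /andP[xt ty].
by rewrite (le_trans x0 (ltW xt)) (le_trans ty yb).
Qed.

Lemma subset_itvcc0 (x b : R) : x <= b -> `[0, x]%classic `<=` `[0, b]%classic.
Proof.
by move=> xb t; rewrite /= !in_itv /= => /andP[-> /le_trans]; exact.
Qed.

Lemma Rintegral_itvoc_le_cst b f c x y :
  bounded_measurable b f -> 0 <= x -> x <= y -> y <= b ->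
  (forall t, x < t <= y -> `|f t| <= c) ->
  `|Rintegral mu `]x, y] f| <= c * (y - x).
Proof.
move=> bf x0 xy yb fc.
have /le_trans : `|Rintegral mu `]x, y] f| <= c * fine (mu `]x, y]).
  apply: (Rintegral_le_cst bf); first exact: itv_completed.
    exact: subset_itvoc0.
  by move=> t; rewrite /= in_itv; exact: fc.
apply; rewrite completed_measure_itv /= lte_fin.
by move: xy; rewrite le_eqVlt => /predU1P[->|->//]; rewrite ltxx subrr.
Qed.

Lemma running_integral0 b f :
  0 <= b -> bounded_measurable b f -> running_integral f 0 = 0.
Proof.
move=> b0 bf; apply/eqP; rewrite -normr_le0; have [_ [M fM]] := bf.
have /le_trans : `|running_integral f 0| <= M * fine (mu `[0, 0]).
  apply: (Rintegral_le_cst bf); first exact: itv_completed.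
    exact: subset_itvcc0.
  move=> t; rewrite /= in_itv /= => /andP[t0 t0'].
  by apply: fM; rewrite t0 (le_trans t0' b0).
by apply; rewrite completed_measure_itv /= ltxx mulr0.
Qed.

Lemma running_integral_split b f x y :
  bounded_measurable b f -> 0 <= x -> x <= y -> y <= b ->
  running_integral f y = running_integral f x + Rintegral mu `]x, y] f.
Proof.
move=> bf x0 xy yb; rewrite /running_integral.
have E : `[0, y]%classic = `[0, x]%classic `|` `]x, y]%classic.
  apply/seteqP; split=> t; rewrite /= !in_itv /=.
    by move=> /andP[-> ->]; rewrite andbT; case: (leP t x) => _; [left | right].
  case=> /andP[t0 tx]; first by rewrite t0 (le_trans tx xy).
  by rewrite tx (le_trans x0 (ltW t0)).
rewrite E Rintegral_setU //.
- exact: itv_completed.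
- exact: itv_completed.
- rewrite -E; apply: (bounded_measurable_integrable bf); first exact: itv_completed.
  exact: subset_itvcc0.
- apply/eqP; apply/seteqP; split=> t //=; rewrite !in_itv /=.
  by case=> /andP[_ tx] /andP[xt _]; move: (lt_le_trans xt tx); rewrite ltxx.
Qed.

(** * Calculus of primitives of bounded measurable functions *)

(** Cutting [0, x] into N equal pieces bounds the variation of H from 0 to x
    by N C (x / N)^2, which tends to 0. *)
Lemma quadratic_increments_constant b C (H : R -> R) :
  (forall x y, 0 <= x -> x <= y -> y <= b -> `|H y - H x| <= C * (y - x) ^+ 2) ->
  forall x, 0 <= x <= b -> H x = H 0.
Proof.
move=> HC x /andP[x0 xb].
have step N k : (k <= N.+1)%N ->
    `|H (k%:R * (x / N.+1%:R)) - H 0| <= k%:R * (C * (x / N.+1%:R) ^+ 2).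
  elim: k => [_|k IH kN]; first by rewrite !mul0r subrr normr0.
  set h := x / N.+1%:R; have h0 : 0 <= h by rewrite divr_ge0.
  have -> : H (k.+1%:R * h) - H 0 =
      (H (k.+1%:R * h) - H (k%:R * h)) + (H (k%:R * h) - H 0) by ring.
  have -> : k.+1%:R * (C * h ^+ 2) = C * h ^+ 2 + k%:R * (C * h ^+ 2).
    by rewrite -natr1; ring.
  apply: (le_trans (ler_normD _ _)); apply: lerD; last exact/IH/ltnW.
  have hE : k.+1%:R * h - k%:R * h = h by rewrite -natr1; ring.
  rewrite -[in leRHS]hE; apply: HC; first exact: mulr_ge0.
  - by rewrite ler_wpM2r // ler_nat.
  - apply: le_trans xb; rewrite /h mulrA ler_pdivrMr ?ltr0n // mulrC.
    by rewrite ler_wpM2l // ler_nat.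
apply/eqP; rewrite -subr_eq0 -normr_le0; apply/ler_addgt0Pr => e e0.
rewrite add0r.
pose N := Num.bound `|C * x ^+ 2 / e|.
have := step N N.+1 (leqnn _).
have -> : N.+1%:R * (x / N.+1%:R) = x by rewrite mulrC divfK ?pnatr_eq0.
move=> /le_trans; apply.
have -> : N.+1%:R * (C * (x / N.+1%:R) ^+ 2) = C * x ^+ 2 / N.+1%:R.
  by field; rewrite addrC natr1 pnatr_eq0.
rewrite ler_pdivrMr ?ltr0n // -ler_pdivrMl // [leLHS]mulrC.
apply: (le_trans (ler_norm _)); apply: ltW.
apply: (lt_le_trans (archi_boundP (normr_ge0 _))).
by rewrite ler_nat.
Qed.

(** The integrated form of F' = f, for F Lipschitz: f is a derivative only
    almost everywhere. *)
Definition primitive_on b F f :=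
  [/\ bounded_measurable b F, bounded_measurable b f &
      forall x, 0 <= x <= b -> F x = F 0 + running_integral f x].

Lemma primitive_incr b F f x y : primitive_on b F f ->
  0 <= x -> x <= y -> y <= b -> F y - F x = Rintegral mu `]x, y] f.
Proof.
move=> [_ bf FE] x0 xy yb.
rewrite (FE y) ?(le_trans x0) // (FE x) ?x0 ?(le_trans xy) //.
rewrite (running_integral_split bf x0 xy yb); ring.
Qed.

Lemma primitive_lipschitz b F f M x y : primitive_on b F f ->
  (forall t, 0 <= t <= b -> `|f t| <= M) ->
  0 <= x -> x <= y -> y <= b -> `|F y - F x| <= M * (y - x).
Proof.
move=> Ff fM x0 xy yb; rewrite (primitive_incr Ff) //; have [_ bf _] := Ff.
apply: (Rintegral_itvoc_le_cst bf) => // t /andP[xt ty]; apply: fM.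
by rewrite (le_trans x0 (ltW xt)) (le_trans ty yb).
Qed.

(** The point is measurability: the integral of a bounded function is
    Lipschitz in its upper bound, hence continuous. *)
Lemma primitive_running_integral b f : 0 <= b -> bounded_measurable b f ->
  primitive_on b (running_integral f) f.
Proof.
move=> b0 bf; have [mf [M fM]] := bf.
have lip x y : 0 <= x -> x <= y -> y <= b ->
    `|running_integral f y - running_integral f x| <= M * (y - x).
  move=> x0 xy yb; rewrite (running_integral_split bf x0 xy yb) addrC addKr.
  apply: (Rintegral_itvoc_le_cst bf) => // t /andP[xt ty]; apply: fM.
  by rewrite (le_trans x0 (ltW xt)) (le_trans ty yb).
have M0 : 0 <= M by rewrite (le_trans (normr_ge0 (f 0))) // fM // lexx.
have lipn x y : 0 <= x <= b -> 0 <= y <= b ->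
    `|running_integral f y - running_integral f x| <= M * `|y - x|.
  move=> /andP[x0 xb] /andP[y0 yb]; case: (leP x y) => xy.
    by rewrite (ger0_norm (_ : 0 <= y - x)) ?subr_ge0 // lip.
  by rewrite distrC (distrC y) (gtr0_norm (_ : 0 < x - y)) ?subr_gt0 // lip // ltW.
have i0 := running_integral0 b0 bf.
split=> //; last by move=> x _; rewrite i0 add0r.
split; last first.
  exists (M * b) => t /andP[t0 tb].
  rewrite -(subr0 (running_integral f t)) -i0; apply: (le_trans (lip _ _ _ _ _)) => //.
  by rewrite subr0 ler_wpM2l.
apply: continuous_on_completed; apply/subspace_continuousP => x xb.
have {}xb : 0 <= x <= b by move: xb; rewrite /= in_itv.
apply/cvgrPdist_lt => e e0.
have d0 : 0 < e / (M + 1) by rewrite divr_gt0 // ltr_wpDl.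
apply/nbhs_ballP; exists (e / (M + 1)) => //= y.
rewrite /ball /= distrC => xy; rewrite in_itv /= => yb.
rewrite distrC; apply: (le_lt_trans (lipn _ _ xb yb)).
apply: (@le_lt_trans _ _ ((M + 1) * `|y - x|)).
  by rewrite ler_wpM2r // lerDl.
by rewrite mulrC -ltr_pdivlMr // ltr_wpDl.
Qed.

Lemma running_integral_eq b f g x : x <= b ->
  (forall t, 0 <= t <= b -> f t = g t) -> running_integral f x = running_integral g x.
Proof.
move=> xb fg; apply: eq_Rintegral => t; rewrite inE /= in_itv /= => /andP[t0 tx].
by apply: fg; rewrite t0 (le_trans tx xb).
Qed.

Lemma running_integralD b f g x : x <= b ->
  bounded_measurable b f -> bounded_measurable b g ->
  running_integral (fun t => f t + g t) x = running_integral f x + running_integral g x.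
Proof.
move=> xb bf bg; have mI := itv_completed `[0, x].
apply: RintegralD => //.
  exact: bounded_measurable_integrable bf mI (subset_itvcc0 xb).
exact: bounded_measurable_integrable bg mI (subset_itvcc0 xb).
Qed.

Lemma running_integralZ b c f x : x <= b -> bounded_measurable b f ->
  running_integral (fun t => c * f t) x = c * running_integral f x.
Proof.
move=> xb bf; have mI := itv_completed `[0, x].
apply: RintegralZl => //.
exact: bounded_measurable_integrable bf mI (subset_itvcc0 xb).
Qed.

Lemma running_integralN b f x : x <= b -> bounded_measurable b f ->
  running_integral (fun t => - f t) x = - running_integral f x.
Proof.
move=> xb bf; rewrite -mulN1r -(running_integralZ _ xb bf).
by apply: eq_Rintegral => t _; rewrite mulN1r.
Qed.

Lemma running_integral_cst c x : 0 <= x -> running_integral (fun=> c) x = c * x.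
Proof.
move=> x0; transitivity (c * fine (mu `[0, x])).
  by apply: Rintegral_cst; exact: itv_completed.
rewrite completed_measure_itv /= lte_fin; case: ltP => [_|x0'].
  by rewrite oppr0 addr0.
by congr (_ * _); apply/le_anti; rewrite x0.
Qed.

Lemma running_integral_norm_le b f g x : x <= b ->
  bounded_measurable b f -> bounded_measurable b g ->
  (forall t, 0 <= t <= x -> `|f t| <= g t) ->
  `|running_integral f x| <= running_integral g x.
Proof.
move=> xb bf bg fg; have mI := itv_completed `[0, x].
have fi := bounded_measurable_integrable bf mI (subset_itvcc0 xb).
have gi := bounded_measurable_integrable bg mI (subset_itvcc0 xb).
apply: (le_trans (le_normr_Rintegral mI fi)).
by apply: le_Rintegral => //; exact: integrable_norm.
Qed.

Lemma primitive_cst b c : primitive_on b (fun=> c) (fun=> 0).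
Proof.
split; try exact: bounded_measurable_cst.
by move=> x /andP[x0 _]; rewrite running_integral_cst // mul0r addr0.
Qed.

Lemma primitive_id b : 0 <= b -> primitive_on b id (fun=> 1).
Proof.
move=> b0.
split; last by move=> x /andP[x0 _]; rewrite running_integral_cst // mul1r add0r.
  split; last by exists b => t /andP[t0 tb]; rewrite ger0_norm.
  apply: continuous_on_completed; apply: continuous_subspaceT.
  by move=> x; exact: cvg_id.
exact: bounded_measurable_cst.
Qed.

Lemma primitiveD b F f G g : primitive_on b F f -> primitive_on b G g ->
  primitive_on b (fun t => F t + G t) (fun t => f t + g t).
Proof.
move=> [bF bf FE] [bG bg GE]; split; try exact: bounded_measurableD.
move=> x xb; rewrite (FE x xb) (GE x xb); case/andP: xb => _ xb.
by rewrite (running_integralD xb bf bg); ring.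
Qed.

Lemma primitiveN b F f : primitive_on b F f ->
  primitive_on b (fun t => - F t) (fun t => - f t).
Proof.
move=> [bF bf FE]; split; try exact: bounded_measurableN.
move=> x xb; rewrite (FE x xb); case/andP: xb => _ xb.
by rewrite (running_integralN xb bf); ring.
Qed.

Lemma primitive0_constant b F f : primitive_on b F f ->
  (forall t, 0 <= t <= b -> f t = 0) -> forall x, 0 <= x <= b -> F x = F 0.
Proof.
move=> [_ _ FE] f0 x xb; rewrite (FE x xb); case/andP: xb => x0 xb.
by rewrite (running_integral_eq xb f0) running_integral_cst // mul0r addr0.
Qed.

(** Integration by parts. Over [x, y] the increment of F G is the integral of
    f(t) G(y) + F(x) g(t), which differs from that of f(t) G(t) + F(t) g(t) by
    O((y - x)^2) because F and G are Lipschitz. *)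
Lemma primitiveM b F f G g : primitive_on b F f -> primitive_on b G g ->
  primitive_on b (fun t => F t * G t) (fun t => f t * G t + F t * g t).
Proof.
move=> Ff Gg; have [bF bf FE] := Ff; have [bG bg GE] := Gg.
have bh : bounded_measurable b (fun t => f t * G t + F t * g t).
  by apply: bounded_measurableD; apply: bounded_measurableM.
split=> //; first exact: bounded_measurableM.
set h := fun t => _.
have [M1 fM] := bf.2; have [M2 gM] := bg.2.
move=> x xb; have b0 : 0 <= b by case/andP: xb => /le_trans; apply.
suff : F x * G x - running_integral h x = F 0 * G 0 - running_integral h 0.
  by rewrite (running_integral0 b0 bh) subr0 => <-; rewrite subrK.
move: x xb; pose H x := F x * G x - running_integral h x; rewrite -/(H 0).
apply: (@quadratic_increments_constant _ ((M1 * M2) *+ 2) H) => x y x0 xy yb.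
have mI := itv_completed `]x, y]; have sI := subset_itvoc0 x0 yb.
have fi := bounded_measurable_integrable bf mI sI.
have gi := bounded_measurable_integrable bg mI sI.
have bu : bounded_measurable b (fun t => G y * f t + F x * g t).
  by apply: bounded_measurableD; exact: bounded_measurableZ.
(* The two products are frozen at opposite ends of [x, y]. *)
have -> : H y - H x = Rintegral mu `]x, y]
    (fun t => (G y * f t + F x * g t) - h t).
  rewrite (@RintegralB _ _ _ mu _ (fun t => G y * f t + F x * g t) h) //;
    last 2 first.
  - exact: bounded_measurable_integrable bu mI sI.
  - exact: bounded_measurable_integrable bh mI sI.
  rewrite (@RintegralD _ _ _ mu _ (fun t => G y * f t) (fun t => F x * g t)) //;
    last 2 first.
  - exact: bounded_measurable_integrable (bounded_measurableZ (G y) bf) mI sI.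
  - exact: bounded_measurable_integrable (bounded_measurableZ (F x) bg) mI sI.
  rewrite !RintegralZl // -(primitive_incr Ff) // -(primitive_incr Gg) //.
  rewrite /H (running_integral_split bh x0 xy yb); ring.
rewrite expr2 mulrA; apply: (Rintegral_itvoc_le_cst (b := b)) => //.
  exact: bounded_measurableB.
move=> t /andP[/ltW xt ty].
have t0 : 0 <= t := le_trans x0 xt.
have tb : t <= b := le_trans ty yb.
have -> : G y * f t + F x * g t - h t =
   f t * (G y - G t) - (F t - F x) * g t by rewrite /h; ring.
apply: (le_trans (ler_normB _ _)); rewrite !normrM mulr2n mulrDl.
have M10 : 0 <= M1 by rewrite (le_trans (normr_ge0 (f t))) // fM // t0.
have M20 : 0 <= M2 by rewrite (le_trans (normr_ge0 (g t))) // gM // t0.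
apply: lerD.
  rewrite -mulrA ler_pM ?fM ?t0 //.
  apply: (le_trans (primitive_lipschitz Gg gM t0 ty yb)).
  by rewrite ler_wpM2l // lerB.
rewrite mulrAC ler_pM ?gM ?t0 //.
apply: (le_trans (primitive_lipschitz Ff fM x0 xt tb)).
by rewrite ler_wpM2l // lerB.
Qed.

Lemma bounded_measurable_lim b (u : nat -> R -> R) f M :
  (forall k, bounded_measurable b (u k)) ->
  (forall t, 0 <= t <= b -> `|f t| <= M) ->
  (forall t, 0 <= t <= b -> (fun k => u k t) @ \oo --> f t) ->
  bounded_measurable b f.
Proof.
move=> bu fM uf; split; last by exists M.
apply: (@measurable_fun_cvg _ (completed_line R) R `[0, b] u f) => [m|t].
  by have [] := bu m.
by rewrite /= in_itv /=; exact: uf.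
Qed.

(** Uniform convergence of both the functions and the derivatives passes to
    the limit under the integral sign, since [0, b] has finite length. *)
Lemma primitive_uniform_limit b (U V : nat -> R -> R) F f (e : nat -> R) :
  (forall k, primitive_on b (U k) (V k)) ->
  (forall k t, 0 <= t <= b -> `|F t - U k t| <= e k) ->
  (forall k t, 0 <= t <= b -> `|f t - V k t| <= e k) ->
  e @ \oo --> 0 -> primitive_on b F f.
Proof.
move=> UV FU fV e0.
have bm (W : nat -> R -> R) G : (forall k, bounded_measurable b (W k)) ->
    (forall k t, 0 <= t <= b -> `|G t - W k t| <= e k) -> bounded_measurable b G.
  move=> bW GW; have [_ [M WM]] := bW 0%N.
  apply: (bounded_measurable_lim (M := e 0%N + M) bW) => t tb.
    rewrite -(subrK (W 0%N t) (G t)) (le_trans (ler_normD _ _)) // lerD ?GW //.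
    exact: WM.
  apply/cvgrPdist_le => d d0; move/cvgrPdist_le : e0 => /(_ _ d0) e0.
  near=> k; apply: (le_trans (GW k t tb)); apply: (le_trans (ler_norm _)).
  by rewrite -normrN -sub0r; near: k.
have bF : bounded_measurable b F by apply: (bm U) => // k; have [] := UV k.
have bf : bounded_measurable b f by apply: (bm V) => // k; have [] := UV k.
split=> // x xb; have /andP[x0 xb'] := xb.
have b0 : 0 <= b := le_trans x0 xb'.
apply/eqP; rewrite -subr_eq0 -normr_le0; apply/ler_addgt0Pr => d d0; rewrite add0r.
have d1 : 0 < d / (2 + x) by rewrite divr_gt0 // ltr_wpDr.
move/cvgrPdist_le : e0 => /(_ _ d1) [N _ /(_ N (leqnn N))] /=.
rewrite sub0r normrN => /(le_trans (ler_norm _)) eN.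
have bV : bounded_measurable b (V N) by have [] := UV N.
have Ub : U N x = U N 0 + running_integral (V N) x by have [_ _ ->] := UV N.
have -> : F x - (F 0 + running_integral f x) =
    (F x - U N x) - (F 0 - U N 0) - running_integral (fun t => f t - V N t) x.
  rewrite Ub (running_integralD xb' bf (bounded_measurableN bV)).
  by rewrite (running_integralN xb' bV); ring.
(* Two errors at the endpoints and one along an interval of length x. *)
have dE : d = d / (2 + x) + d / (2 + x) + d / (2 + x) * x.
  by field; rewrite gt_eqF // ltr_wpDr.
rewrite [leRHS]dE; apply: (le_trans (ler_normB _ _)); apply: lerD.
  apply: (le_trans (ler_normB _ _)); apply: lerD.
    exact: (le_trans (FU N x xb)).
  by apply: (le_trans (FU N 0 _)) => //; rewrite lexx.
rewrite -running_integral_cst //; apply: (running_integral_norm_le xb').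
- exact: bounded_measurableB.
- exact: bounded_measurable_cst.
- move=> t /andP[t0 tx]; apply: (le_trans (fV N t _)) => //.
  by rewrite t0 (le_trans tx xb').
Unshelve. all: by end_near. Qed.

Lemma primitive_expn b k : 0 <= b ->
  primitive_on b (fun t => t ^+ k.+1) (fun t => k.+1%:R * t ^+ k).
Proof.
move=> b0; elim: k => [|k IH].
  have := primitive_id b0; congr (primitive_on _ _ _); apply/funext => t.
  by rewrite expr0 mulr1.
have := primitiveM (primitive_id b0) IH; congr (primitive_on _ _ _).
by apply/funext => t; rewrite -[in RHS]natr1 !exprS; ring.
Qed.

(** The weight c (c t)^k / k! is the derivative of (c t)^(k+1) / (k+1)!; it
    carries the factorial bound on the terms of the series from k to k + 1. *)
Lemma bounded_measurable_expn b c k : 0 <= b ->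
  bounded_measurable b (fun t => c * (c * t) ^+ k / k`!%:R).
Proof.
move=> b0; have [_ bp _] := primitive_expn k b0.
have := bounded_measurableZ (c ^+ k.+1 / k.+1`!%:R) bp.
congr (bounded_measurable _ _); apply/funext => t.
rewrite exprMn exprS factS natrM; field.
by rewrite !pnatr_eq0 -lt0n fact_gt0 addrC natr1 pnatr_eq0.
Qed.

Lemma running_integral_expn k c x : 0 <= x ->
  running_integral (fun t => c * (c * t) ^+ k / k`!%:R) x =
  (c * x) ^+ k.+1 / k.+1`!%:R.
Proof.
move=> x0; have [bp bp' /(_ x)] := primitive_expn k x0.
rewrite lexx x0 => /(_ isT); rewrite expr0n add0r => xE.
rewrite exprMn xE.
rewrite (_ : (fun t => _) = fun t => (c ^+ k.+1 / k.+1`!%:R) * (k.+1%:R * t ^+ k)).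
  by rewrite (running_integralZ _ (lexx x) bp'); ring.
apply/funext => t; rewrite exprMn exprS factS natrM; field.
by rewrite !pnatr_eq0 -lt0n fact_gt0 addrC natr1 pnatr_eq0.
Qed.

(** The tail of the majorant bounds the rest uniformly over all dominated
    series. *)
Lemma series_dominated (z u : nat -> R) :
  (forall k, `|z k| <= u k) -> cvgn (series u) ->
  cvgn (series z) /\
  forall N, `|limn (series z) - series z N| <= limn (series u) - series u N.
Proof.
move=> zu cu.
have cz : cvgn (series z).
  apply: normed_cvg; apply: (series_le_cvg _ _ zu cu) => k //=.
  exact: le_trans (zu k).
split=> // N.
have c1 : (fun m => `|series z m - series z N|) @ \oo -->
   `|limn (series z) - series z N|.
  by apply: cvg_norm; apply: cvgB => //; exact: cvg_cst.
have c2 : (fun m => series u m - series u N) @ \oo --> limn (series u) - series u N.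
  by apply: cvgB => //; exact: cvg_cst.
apply: (ler_cvg_to c1 c2); near=> m.
have Nm : (N <= m)%N by near: m; exact: nbhs_infty_ge.
rewrite !sub_series_geq //; apply: (le_trans (ler_norm_sum _ _ _)).
by apply: ler_sum.
Unshelve. all: by end_near. Qed.

End RealCalculus.

(** * Real and complex scalars *)

Section Scalars.
Context {R : realType} {s : scalars}.
Local Notation K := (scalar_field R s).
Implicit Types (z w : K) (b x y t : R) (F G f g : R -> K).

(** Real and imaginary parts over both fields at once, the imaginary part of
    a real scalar being 0: the product formulas of C then hold in both cases, and
    every statement on K reduces to statements on R. *)
Definition scalar_re : K -> R :=
  match s as s0 return scalar_field R s0 -> R with
  | RealScalars => fun r => r
  | ComplexScalars => fun c => complex.Re c
  end.

Definition scalar_im : K -> R :=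
  match s as s0 return scalar_field R s0 -> R with
  | RealScalars => fun=> 0
  | ComplexScalars => fun c => complex.Im c
  end.

Lemma scalar_ext z w :
  scalar_re z = scalar_re w -> scalar_im z = scalar_im w -> z = w.
Proof.
by rewrite /scalar_re /scalar_im; case: s z w => //= -[a c] [a' c'] /= -> ->.
Qed.

Lemma scalar_reD z w : scalar_re (z + w) = scalar_re z + scalar_re w.
Proof. by rewrite /scalar_re; case: s z w => //= -[? ?] []. Qed.

Lemma scalar_imD z w : scalar_im (z + w) = scalar_im z + scalar_im w.
Proof. by rewrite /scalar_im; case: s z w => /= [_ _|[? ?] []//]; rewrite addr0. Qed.

Lemma scalar_reN z : scalar_re (- z) = - scalar_re z.
Proof. by rewrite /scalar_re; case: s z => //= -[]. Qed.

Lemma scalar_imN z : scalar_im (- z) = - scalar_im z.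
Proof. by rewrite /scalar_im; case: s z => /= [_|[]//]; rewrite oppr0. Qed.

Lemma scalar_reM z w :
  scalar_re (z * w) = scalar_re z * scalar_re w - scalar_im z * scalar_im w.
Proof.
by rewrite /scalar_re /scalar_im; case: s z w => /= [z w|[? ?] []//];
  rewrite mul0r subr0.
Qed.

Lemma scalar_imM z w :
  scalar_im (z * w) = scalar_re z * scalar_im w + scalar_im z * scalar_re w.
Proof.
by rewrite /scalar_re /scalar_im; case: s z w => /= [z w|[? ?] []//];
  rewrite mul0r mulr0 addr0.
Qed.

Lemma scalar_re0 : scalar_re 0 = 0. Proof. by rewrite /scalar_re; case: s. Qed.
Lemma scalar_im0 : scalar_im 0 = 0. Proof. by rewrite /scalar_im; case: s. Qed.
Lemma scalar_re1 : scalar_re 1 = 1. Proof. by rewrite /scalar_re; case: s. Qed.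
Lemma scalar_im1 : scalar_im 1 = 0. Proof. by rewrite /scalar_im; case: s. Qed.

Lemma scalar_re_sum (u : nat -> K) N :
  scalar_re (series u N) = series (scalar_re \o u) N.
Proof.
rewrite /series /=; elim: N => [|N IH]; first by rewrite !big_nil scalar_re0.
by rewrite !big_nat_recr //= scalar_reD IH.
Qed.

Lemma scalar_im_sum (u : nat -> K) N :
  scalar_im (series u N) = series (scalar_im \o u) N.
Proof.
rewrite /series /=; elim: N => [|N IH]; first by rewrite !big_nil scalar_im0.
by rewrite !big_nat_recr //= scalar_imD IH.
Qed.

Lemma scalar_re_integral D f :
  scalar_re (scalar_integral D f) =
  Rintegral (@completed_lebesgue_measure R) D (scalar_re \o f).
Proof. by rewrite /scalar_re; case: s f. Qed.

Lemma scalar_im_integral D f :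
  scalar_im (scalar_integral D f) =
  Rintegral (@completed_lebesgue_measure R) D (scalar_im \o f).
Proof.
rewrite /scalar_im; case: s f => //= f.
by rewrite /Rintegral integral0_eq.
Qed.

(** In the complex case the modulus is at most the sum of the absolute values
    of the two parts. *)
Lemma scalar_cvg (u : nat -> K) z :
  scalar_re \o u @ \oo --> scalar_re z ->
  scalar_im \o u @ \oo --> scalar_im z -> u @ \oo --> z.
Proof.
rewrite /scalar_re /scalar_im; case: s u z => //= u z ure uim.
pose C := scalar_field R ComplexScalars.
apply/(@cvgrPdist_lt C C) => e e0.
have [e1 e10 eE] : exists2 e1 : R, 0 < e1 & e = e1%:C%C.
  exists (complex.Re e); first by move: e0; rewrite ltcE => /andP[].
  by move: e0; case: e => a c; rewrite ltcE /= => /andP[/eqP -> _].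
have e20 : 0 < e1 / 2 by rewrite divr_gt0.
move/cvgrPdist_lt : ure => /(_ _ e20) ure.
move/cvgrPdist_lt : uim => /(_ _ e20) uim.
near=> k.
have reb : `|complex.Re z - complex.Re (u k)| < e1 / 2 by near: k.
have imb : `|complex.Im z - complex.Im (u k)| < e1 / 2 by near: k.
rewrite eE [z - u k]complexE; apply: (le_lt_trans (ler_normD _ _)).
rewrite normrM.
have n1 (r : R) : `|r%:C%C| = `|r|%:C%C :> R[i].
  by rewrite normc_def /= expr0n /= addr0 sqrtr_sqr.
have -> : `|('i : R[i])%C| = 1.
  by rewrite normc_def /= expr0n /= add0r expr1n sqrtr1.
rewrite mul1r !n1 -rmorphD ltcR /=.
have -> : complex.Re (z - u k) = complex.Re z - complex.Re (u k).
  by case: (z) => ? ?; case: (u k).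
have -> : complex.Im (z - u k) = complex.Im z - complex.Im (u k).
  by case: (z) => ? ?; case: (u k).
by rewrite [ltRHS](splitr e1) ltrD.
Unshelve. all: by end_near. Qed.

(** A bound on both parts replaces the modulus: it takes values in R and it is
    inherited by integrals part by part. The price is the factor 2 of
    [scalar_leM]. *)
Definition scalar_le z (c : R) := `|scalar_re z| <= c /\ `|scalar_im z| <= c.
Lemma scalar_leW z c d : scalar_le z c -> c <= d -> scalar_le z d.
Proof. by move=> [zc zc'] cd; split; rewrite (le_trans _ cd). Qed.

Lemma scalar_le0 : scalar_le 0 0.
Proof. by rewrite /scalar_le scalar_re0 scalar_im0 normr0. Qed.

Lemma scalar_le1 : scalar_le 1 1.
Proof. by rewrite /scalar_le scalar_re1 scalar_im1 normr0 normr1. Qed.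

Lemma scalar_leD z w c d :
  scalar_le z c -> scalar_le w d -> scalar_le (z + w) (c + d).
Proof.
move=> [zc zc'] [wd wd']; rewrite /scalar_le scalar_reD scalar_imD.
by split; rewrite (le_trans (ler_normD _ _)) // lerD.
Qed.

Lemma scalar_leM z w c d :
  scalar_le z c -> scalar_le w d -> scalar_le (z * w) (2 * (c * d)).
Proof.
move=> [zc zc'] [wd wd']; rewrite /scalar_le scalar_reM scalar_imM.
by rewrite mulr2n mulrDl mul1r; split;
  [apply: (le_trans (ler_normB _ _)) | apply: (le_trans (ler_normD _ _))];
  rewrite !normrM lerD // ler_pM.
Qed.

Lemma scalar_norm_le z c : `|z| <= c -> scalar_le z (scalar_re c).
Proof.
rewrite /scalar_le /scalar_re /scalar_im; case: s z c => /= z c zc.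
  by split=> //; rewrite normr0 (le_trans _ zc).
have h (a : R) : `|a|%:C%C <= `|z| -> `|a| <= complex.Re c.
  by move=> /le_trans /(_ zc); rewrite lecE => /andP[].
split; apply: h; first exact: normc_ge_Re.
rewrite -[leRHS]mul1r.
have <- : `|('i : R[i])%C| = 1.
  by rewrite normc_def /= expr0n /= add0r expr1n sqrtr1.
by rewrite -normrM mulrC -normrN -ReiNIm normc_ge_Re.
Qed.

Definition scalar_bounded_measurable b f :=
  bounded_measurable b (scalar_re \o f) /\ bounded_measurable b (scalar_im \o f).

Lemma scalar_bounded_integrable_measurable b f :
  [bounded f t | t in `[0, b]] -> scalar_integrable `[0, b] f ->
  scalar_bounded_measurable b f.
Proof.
move=> [M [Mr fM]] fi.
have {}fM t : 0 <= t <= b -> scalar_le (f t) (scalar_re (`|M| + 1)).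
  move=> tb; apply: scalar_norm_le; apply: fM; last by rewrite /= in_itv.
  by rewrite (le_lt_trans (real_ler_norm Mr)) ?ltrDl.
have bre : exists N, forall t, 0 <= t <= b -> `|scalar_re (f t)| <= N.
  by eexists => t /fM [h _]; exact: h.
have bim : exists N, forall t, 0 <= t <= b -> `|scalar_im (f t)| <= N.
  by eexists => t /fM [_ h]; exact: h.
suff [mre mim] : measurable_fun (`[0, b] : set (completed_line R)) (scalar_re \o f) /\
  measurable_fun (`[0, b] : set (completed_line R)) (scalar_im \o f) by [].
move: fi; rewrite /scalar_re /scalar_im; case: s f {M Mr fM bre bim} => /= f.
  move=> /measurable_int /measurable_EFinP mf; split=> //.
  exact: measurable_cst.
by move=> [/measurable_int /measurable_EFinP mf /measurable_int /measurable_EFinP mg].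
Qed.

Lemma scalar_bounded_measurable_le b f : scalar_bounded_measurable b f ->
  exists M, forall t, 0 <= t <= b -> scalar_le (f t) M.
Proof.
move=> [[_ [M fM]] [_ [N fN]]]; exists (Num.max M N) => t tb.
by split; rewrite le_max ?fM ?fN ?orbT.
Qed.

Lemma scalar_bounded_measurable_cst b z : scalar_bounded_measurable b (fun=> z).
Proof. by split; exact: bounded_measurable_cst. Qed.

Lemma scalar_bounded_measurableD b f g :
  scalar_bounded_measurable b f -> scalar_bounded_measurable b g ->
  scalar_bounded_measurable b (fun t => f t + g t).
Proof.
move=> [fr fi] [gr gi]; split.
  rewrite (_ : _ \o _ = fun t => scalar_re (f t) + scalar_re (g t)).
    exact: bounded_measurableD.
  by apply/funext => t /=; rewrite scalar_reD.
rewrite (_ : _ \o _ = fun t => scalar_im (f t) + scalar_im (g t)).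
  exact: bounded_measurableD.
by apply/funext => t /=; rewrite scalar_imD.
Qed.

Lemma scalar_bounded_measurableN b f :
  scalar_bounded_measurable b f -> scalar_bounded_measurable b (fun t => - f t).
Proof.
move=> [fr fi]; split.
  rewrite (_ : _ \o _ = fun t => - scalar_re (f t)).
    exact: bounded_measurableN.
  by apply/funext => t /=; rewrite scalar_reN.
rewrite (_ : _ \o _ = fun t => - scalar_im (f t)).
  exact: bounded_measurableN.
by apply/funext => t /=; rewrite scalar_imN.
Qed.

Lemma scalar_bounded_measurableM b f g :
  scalar_bounded_measurable b f -> scalar_bounded_measurable b g ->
  scalar_bounded_measurable b (fun t => f t * g t).
Proof.
move=> [fr fi] [gr gi]; split.
  rewrite (_ : _ \o _ = fun t => scalar_re (f t) * scalar_re (g t)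
                              - scalar_im (f t) * scalar_im (g t)).
    by apply: bounded_measurableB; exact: bounded_measurableM.
  by apply/funext => t /=; rewrite scalar_reM.
rewrite (_ : _ \o _ = fun t => scalar_re (f t) * scalar_im (g t)
                             + scalar_im (f t) * scalar_re (g t)).
  by apply: bounded_measurableD; exact: bounded_measurableM.
by apply/funext => t /=; rewrite scalar_imM.
Qed.

Lemma scalar_bounded_measurable_sum b (I : Type) (r : seq I) (f : I -> R -> K) :
  (forall i, scalar_bounded_measurable b (f i)) ->
  scalar_bounded_measurable b (fun t => \sum_(i <- r) f i t).
Proof.
move=> bf; elim: r => [|i r IH].
  rewrite (_ : (fun=> _) = fun=> 0); first exact: scalar_bounded_measurable_cst.
  by apply/funext => t; rewrite big_nil.
rewrite (_ : (fun=> _) = fun t => f i t + \sum_(j <- r) f j t).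
  exact: scalar_bounded_measurableD.
by apply/funext => t; rewrite big_cons.
Qed.

Definition scalar_primitive_on b F f :=
  primitive_on b (scalar_re \o F) (scalar_re \o f) /\
  primitive_on b (scalar_im \o F) (scalar_im \o f).

Lemma scalar_primitive_bounded b F f : scalar_primitive_on b F f ->
  scalar_bounded_measurable b F /\ scalar_bounded_measurable b f.
Proof. by move=> [[? ? _] [? ? _]]. Qed.

Definition scalar_running_integral f x : K := scalar_integral `[0, x] f.

Lemma scalar_primitiveE b F f x : scalar_primitive_on b F f -> 0 <= x <= b ->
  F x = F 0 + scalar_running_integral f x.
Proof.
move=> [[_ _ rE] [_ _ iE]] xb; apply: scalar_ext.
  by rewrite scalar_reD scalar_re_integral; exact: rE.
by rewrite scalar_imD scalar_im_integral; exact: iE.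
Qed.

Lemma scalar_running_integral0 b f :
  0 <= b -> scalar_bounded_measurable b f -> scalar_running_integral f 0 = 0.
Proof.
move=> b0 [fr fi]; apply: scalar_ext.
  by rewrite scalar_re_integral scalar_re0; exact: running_integral0 b0 fr.
by rewrite scalar_im_integral scalar_im0; exact: running_integral0 b0 fi.
Qed.

Lemma scalar_running_integral_eq b f g x : x <= b ->
  (forall t, 0 <= t <= b -> f t = g t) ->
  scalar_running_integral f x = scalar_running_integral g x.
Proof.
move=> xb fg; apply: scalar_ext.
  rewrite !scalar_re_integral; apply: (running_integral_eq xb) => t tb.
  by rewrite /= fg.
rewrite !scalar_im_integral; apply: (running_integral_eq xb) => t tb.
by rewrite /= fg.
Qed.

Lemma scalar_running_integral_cst1 z : scalar_running_integral (fun=> z) 1 = z.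
Proof.
apply: scalar_ext; [rewrite scalar_re_integral | rewrite scalar_im_integral];
  rewrite -[RHS]mulr1; exact: running_integral_cst.
Qed.

Lemma scalar_primitive_running_integral b f : 0 <= b -> scalar_bounded_measurable b f ->
  scalar_primitive_on b (scalar_running_integral f) f.
Proof.
move=> b0 [fr fi]; split.
  rewrite (_ : _ \o _ = running_integral (scalar_re \o f)).
    exact: primitive_running_integral.
  by apply/funext => x; exact: scalar_re_integral.
rewrite (_ : _ \o _ = running_integral (scalar_im \o f)).
  exact: primitive_running_integral.
by apply/funext => x; exact: scalar_im_integral.
Qed.

Lemma scalar_primitive_eq b F G f g : F =1 G -> f =1 g ->
  scalar_primitive_on b F f -> scalar_primitive_on b G g.
Proof. by move=> /funext -> /funext ->. Qed.

Lemma scalar_primitive_cst b z : scalar_primitive_on b (fun=> z) (fun=> 0).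
Proof.
split.
  rewrite [X in primitive_on _ _ X](_ : _ = fun=> 0).
    exact: primitive_cst.
  by apply/funext => t /=; rewrite scalar_re0.
rewrite [X in primitive_on _ _ X](_ : _ = fun=> 0).
  exact: primitive_cst.
by apply/funext => t /=; rewrite scalar_im0.
Qed.

Lemma scalar_primitiveD b F f G g :
  scalar_primitive_on b F f -> scalar_primitive_on b G g ->
  scalar_primitive_on b (fun t => F t + G t) (fun t => f t + g t).
Proof.
move=> [Fr Fi] [Gr Gi]; split.
  rewrite (_ : _ \o _ = fun t => scalar_re (F t) + scalar_re (G t)).
    rewrite [X in primitive_on _ _ X](_ : _ = fun t => scalar_re (f t) + scalar_re (g t)).
      exact: primitiveD.
    by apply/funext => t /=; rewrite scalar_reD.
  by apply/funext => t /=; rewrite scalar_reD.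
rewrite (_ : _ \o _ = fun t => scalar_im (F t) + scalar_im (G t)).
  rewrite [X in primitive_on _ _ X](_ : _ = fun t => scalar_im (f t) + scalar_im (g t)).
    exact: primitiveD.
  by apply/funext => t /=; rewrite scalar_imD.
by apply/funext => t /=; rewrite scalar_imD.
Qed.

Lemma scalar_primitiveM b F f G g :
  scalar_primitive_on b F f -> scalar_primitive_on b G g ->
  scalar_primitive_on b (fun t => F t * G t) (fun t => f t * G t + F t * g t).
Proof.
move=> [Fr Fi] [Gr Gi]; split.
  have := primitiveD (primitiveM Fr Gr) (primitiveN (primitiveM Fi Gi)).
  congr (primitive_on _ _ _); apply/funext => t /=.
    by rewrite scalar_reM.
  by rewrite scalar_reD !scalar_reM; ring.
have := primitiveD (primitiveM Fr Gi) (primitiveM Fi Gr).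
congr (primitive_on _ _ _); apply/funext => t /=.
  by rewrite scalar_imM.
by rewrite scalar_imD !scalar_imM; ring.
Qed.

Lemma scalar_primitive0_constant b F f x : scalar_primitive_on b F f ->
  (forall t, 0 <= t <= b -> f t = 0) -> 0 <= x <= b -> F x = F 0.
Proof.
move=> [Fr Fi] f0 xb; apply: scalar_ext.
  apply: (primitive0_constant Fr _ xb) => t tb.
  by rewrite /= f0 // scalar_re0.
apply: (primitive0_constant Fi _ xb) => t tb.
by rewrite /= f0 // scalar_im0.
Qed.

Lemma scalar_primitive_sum b (I : Type) (r : seq I) (F f : I -> R -> K) :
  (forall i, scalar_primitive_on b (F i) (f i)) ->
  scalar_primitive_on b (fun t => \sum_(i <- r) F i t) (fun t => \sum_(i <- r) f i t).
Proof.
move=> Ff; elim: r => [|i r IH].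
  apply: (scalar_primitive_eq _ _ (scalar_primitive_cst b 0)) => t; by rewrite big_nil.
apply: (scalar_primitive_eq _ _ (scalar_primitiveD (Ff i) IH)) => t;
  by rewrite big_cons.
Qed.

(** The derivative differentiates one factor at a time; this shape makes each
    summand a product in which a single index is treated differently, as in a
    determinant with one row replaced. *)
Lemma scalar_primitive_prod b (I : eqType) (r : seq I) (F f : I -> R -> K) :
  uniq r -> (forall i, scalar_primitive_on b (F i) (f i)) ->
  scalar_primitive_on b (fun t => \prod_(j <- r) F j t)
    (fun t => \sum_(i <- r) \prod_(j <- r) (if j == i then f j t else F j t)).
Proof.
move=> + Ff; elim: r => [_|a r IH /= /andP[ar ur]].
  by apply: (scalar_primitive_eq _ _ (scalar_primitive_cst b 1)) => t; rewrite big_nil.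
apply: (scalar_primitive_eq _ _ (scalar_primitiveM (Ff a) (IH ur))) => t.
  by rewrite big_cons.
rewrite big_cons big_cons eqxx; congr (_ * _ + _).
  apply: eq_big_seq => j jr; case: eqP => // ja.
  by rewrite -ja jr in ar.
rewrite mulr_sumr; apply: eq_big_seq => i ir.
rewrite big_cons; case: eqP => // ai; by rewrite ai ir in ar.
Qed.

End Scalars.

(** * Limits of primitives and of series of scalars *)

Section ScalarSeries.
Context {R : realType} {s : scalars}.
Local Notation K := (scalar_field R s).
Implicit Types (z : nat -> K) (l : K) (b x t : R) (F f : R -> K).

Lemma scalar_primitive_uniform_limit b (U V : nat -> R -> K) F f (e : nat -> R) :
  (forall k, scalar_primitive_on b (U k) (V k)) ->
  (forall k t, 0 <= t <= b -> scalar_le (F t - U k t) (e k)) ->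
  (forall k t, 0 <= t <= b -> scalar_le (f t - V k t) (e k)) ->
  e @ \oo --> 0 -> scalar_primitive_on b F f.
Proof.
move=> UV FU fV e0; split.
- apply: (primitive_uniform_limit (U := fun k => scalar_re \o U k)
    (V := fun k => scalar_re \o V k) (e := e)) => // k; first by have [] := UV k.
    by move=> t /(FU k) []; rewrite scalar_reD scalar_reN.
  by move=> t /(fV k) []; rewrite scalar_reD scalar_reN.
- apply: (primitive_uniform_limit (U := fun k => scalar_im \o U k)
    (V := fun k => scalar_im \o V k) (e := e)) => // k; first by have [] := UV k.
    by move=> t /(FU k) []; rewrite scalar_imD scalar_imN.
  by move=> t /(fV k) []; rewrite scalar_imD scalar_imN.
Qed.

(** Completeness of K by parts; over R the constant imaginary part 0 forces
    the limit c to be 0. *)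
Lemma scalar_parts_limit z (a c : R) :
  scalar_re \o z @ \oo --> a -> scalar_im \o z @ \oo --> c ->
  exists l, scalar_re l = a /\ scalar_im l = c.
Proof.
rewrite /scalar_re /scalar_im; case: s z => /= z za zc; last by exists (Complex a c).
exists a; split=> //.
have z0 : (fun=> 0 : R) @ \oo --> c by [].
by have := cvg_unique _ z0 (cvg_cst _) => /= ->.
Qed.

Lemma scalar_series_dominated z (u : nat -> R) :
  (forall k, scalar_le (z k) (u k)) -> cvgn (series u) ->
  exists l, series z @ \oo --> l /\
    forall N, scalar_le (l - series z N) (limn (series u) - series u N).
Proof.
move=> zu cu.
have [cr tr] := series_dominated (fun k => (zu k).1) cu.
have [ci ti] := series_dominated (fun k => (zu k).2) cu.
have rE : scalar_re \o series z = series (scalar_re \o z).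
  by apply/funext => N; exact: scalar_re_sum.
have iE : scalar_im \o series z = series (scalar_im \o z).
  by apply/funext => N; exact: scalar_im_sum.
have [||l [lr li]] := @scalar_parts_limit (series z)
  (limn (series (scalar_re \o z))) (limn (series (scalar_im \o z))).
- by rewrite rE.
- by rewrite iE.
exists l; split.
  by apply: scalar_cvg; rewrite ?rE ?iE ?lr ?li.
move=> N; rewrite /scalar_le scalar_reD scalar_reN scalar_imD scalar_imN.
by rewrite scalar_re_sum scalar_im_sum lr li.
Qed.

Lemma scalar_le_sum (I : Type) (r : seq I) (v : I -> K) (c : R) :
  (forall i, scalar_le (v i) c) ->
  scalar_le (\sum_(i <- r) v i) ((size r)%:R * c).
Proof.
move=> vc; elim: r => [|i r IH].
  by rewrite big_nil mul0r; exact: scalar_le0.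
by rewrite big_cons /= -natr1 mulrDl mul1r addrC; exact: scalar_leD.
Qed.

End ScalarSeries.

(** * Matrix functions and Jacobi's formula *)

Section MatrixCalculus.
Context {R : realType} {s : scalars}.
Local Notation K := (scalar_field R s).

Lemma mx_cvg m n (u : nat -> 'M[K]_(m, n)) (l : 'M[K]_(m, n)) :
  (forall i j, (fun k => u k i j) @ \oo --> l i j) -> u @ \oo --> l.
Proof.
move=> ul; apply/cvg_ballP => e e0.
have {}ul : \forall k \near \oo, forall i, forall j, ball (l i j) e (u k i j).
  apply: filter_forall => i; apply: filter_forall => j.
  exact: (cvg_ball (ul i j)).
by near=> k; split=> //; near: k.
Unshelve. all: by end_near. Qed.

Context {n : nat}.
Implicit Types (A B : 'M[K]_n) (b x t : R) (X F G f g : R -> 'M[K]_n).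

Definition mx_le A (c : R) := forall i j, scalar_le (A i j) c.

Lemma mx_leM A B c d :
  mx_le A c -> mx_le B d -> mx_le (A *m B) (n%:R * (2 * (c * d))).
Proof.
move=> Ac Bd i j; rewrite mxE -[X in X%:R](card_ord n) cardE.
rewrite -big_enum; apply: scalar_le_sum => k; exact: scalar_leM.
Qed.

Definition mx_bounded_measurable b F :=
  forall i j, scalar_bounded_measurable b (fun t => F t i j).

Definition mx_primitive_on b F f :=
  forall i j, scalar_primitive_on b (fun t => F t i j) (fun t => f t i j).

Lemma mx_bounded_measurable_le b F : mx_bounded_measurable b F ->
  exists M, forall t, 0 <= t <= b -> mx_le (F t) M.
Proof.
move=> bF.
pose M i j := xget 0
  [set M | forall t, 0 <= t <= b -> scalar_le (F t i j) M].
exists (\big[Num.max/0]_i \big[Num.max/0]_j M i j) => t tb i j.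
apply: (@scalar_leW _ _ _ (M i j)).
  have := xgetPex 0 (scalar_bounded_measurable_le (bF i j)); exact.
by apply: (le_trans (le_bigmax _ _ j)); apply: (le_bigmax _ (fun i => _) i).
Qed.

Lemma mx_bounded_measurableM b F G :
  mx_bounded_measurable b F -> mx_bounded_measurable b G ->
  mx_bounded_measurable b (fun t => F t *m G t).
Proof.
move=> bF bG i j; under eq_fun do rewrite mxE.
by apply: scalar_bounded_measurable_sum => k; exact: scalar_bounded_measurableM.
Qed.

Lemma mx_primitive_bounded b F f : mx_primitive_on b F f ->
  mx_bounded_measurable b F /\ mx_bounded_measurable b f.
Proof. by move=> Ff; split=> i j; have [] := scalar_primitive_bounded (Ff i j). Qed.

Lemma mx_primitive_eq b F G f g : F =1 G -> f =1 g ->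
  mx_primitive_on b F f -> mx_primitive_on b G g.
Proof. by move=> /funext -> /funext ->. Qed.

Lemma mx_primitive_uniform_limit b (U V : nat -> R -> 'M[K]_n) F f (e : nat -> R) :
  (forall k, mx_primitive_on b (U k) (V k)) ->
  (forall k t, 0 <= t <= b -> mx_le (F t - U k t) (e k)) ->
  (forall k t, 0 <= t <= b -> mx_le (f t - V k t) (e k)) ->
  e @ \oo --> 0 -> mx_primitive_on b F f.
Proof.
move=> UV FU fV e0 i j.
apply: (scalar_primitive_uniform_limit (fun k => UV k i j) _ _ e0) => k t tb.
  by have := FU k t tb i j; rewrite !mxE.
by have := fV k t tb i j; rewrite !mxE.
Qed.

Lemma mx_primitive_cst b A : mx_primitive_on b (fun=> A) (fun=> 0).
Proof.
move=> i j; apply: (scalar_primitive_eq _ _ (scalar_primitive_cst b (A i j))) => // t.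
by rewrite mxE.
Qed.

Lemma mx_primitiveD b F G f g : mx_primitive_on b F f -> mx_primitive_on b G g ->
  mx_primitive_on b (fun t => F t + G t) (fun t => f t + g t).
Proof.
move=> Ff Gg i j.
apply: (scalar_primitive_eq _ _ (scalar_primitiveD (Ff i j) (Gg i j))) => t;
  by rewrite mxE.
Qed.

Lemma mx_primitiveM b F G f g : mx_primitive_on b F f -> mx_primitive_on b G g ->
  mx_primitive_on b (fun t => F t *m G t) (fun t => f t *m G t + F t *m g t).
Proof.
move=> Ff Gg i j.
have := scalar_primitive_sum (index_enum 'I_n)
  (fun k => scalar_primitiveM (Ff i k) (Gg k j)).
apply: scalar_primitive_eq => t; first by rewrite mxE.
by rewrite !mxE big_split.
Qed.

Lemma mx_primitive_integral b f : 0 <= b -> mx_bounded_measurable b f ->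
  mx_primitive_on b (fun x => mx_integral `[0, x] f) f.
Proof.
move=> b0 bf i j.
have := scalar_primitive_running_integral b0 (bf i j).
by apply: scalar_primitive_eq => x //;
  rewrite mxE.
Qed.
Lemma mx_primitive0_constant b F f x : mx_primitive_on b F f ->
  (forall t, 0 <= t <= b -> f t = 0) -> 0 <= x <= b -> F x = F 0.
Proof.
move=> Ff f0 xb; apply/matrixP => i j.
by apply: (scalar_primitive0_constant (Ff i j)) => // t tb; rewrite f0 // mxE.
Qed.

(** Jacobi's formula. By the product rule the derivative is the sum over i of
    the determinants of F with row i replaced by row i of f; expanding along that
    row leaves the cofactors of F. *)
Lemma det_primitive b F f : mx_primitive_on b F f ->
  scalar_primitive_on b (fun t => \det (F t)) (fun t => \tr (f t *m \adj (F t))).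
Proof.
move=> Ff.
have Fsf (sg : {perm 'I_n}) := scalar_primitiveM
  (scalar_primitive_cst b ((-1) ^+ sg : K))
  (scalar_primitive_prod (index_enum_uniq 'I_n) (fun i => Ff i (sg i))).
have := scalar_primitive_sum (index_enum {perm 'I_n}) Fsf.
apply: scalar_primitive_eq => t //.
under eq_bigr do rewrite mul0r add0r mulr_sumr.
rewrite exchange_big /=; apply: eq_bigr => i _.
pose Fi := \matrix_(k, j) (if k == i then f t k j else F t k j).
transitivity (\det Fi).
  apply: eq_bigr => sg _; congr (_ * _); apply: eq_bigr => j _.
  by rewrite mxE.
rewrite (expand_det_row _ i) mxE; apply: eq_bigr => j _.
rewrite !mxE eqxx; congr (_ * _); rewrite /cofactor; congr (_ * \det _).
by apply/matrixP => k l; rewrite !mxE eq_sym (negPf (neq_lift i k)).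
Qed.

End MatrixCalculus.

(** * Convergence of the series E and its integral equation *)

Section IntegralSeries.
Context {R : realType} {s : scalars} {n : nat}.
Local Notation K := (scalar_field R s).
Implicit Types (b x t : R) (X F G : R -> 'M[K]_n).

Lemma E_term_primitive b X k : 0 <= b -> mx_bounded_measurable b X ->
  mx_primitive_on b (E_term X k.+1) (fun t => X t *m E_term X k t).
Proof.
move=> b0 bX; elim: k => [|k IH]; apply: mx_primitive_integral => //;
  apply: mx_bounded_measurableM => //.
  by have [] := mx_primitive_bounded (mx_primitive_cst b (1%:M : 'M[K]_n)).
by have [] := mx_primitive_bounded IH.
Qed.

Lemma E_term_bounded_measurable b X k : 0 <= b -> mx_bounded_measurable b X ->
  mx_bounded_measurable b (E_term X k).
Proof.
move=> b0 bX; case: k => [|k].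
  by have [] := mx_primitive_bounded (mx_primitive_cst b (1%:M : 'M[K]_n)).
by have [] := mx_primitive_bounded (E_term_primitive k b0 bX).
Qed.

Lemma E_termS_at0 b X k : 0 <= b -> mx_bounded_measurable b X ->
  E_term X k.+1 0 = 0.
Proof.
move=> b0 bX; apply/matrixP => i j; rewrite !mxE.
apply: (scalar_running_integral0 b0); apply: mx_bounded_measurableM => //.
exact: E_term_bounded_measurable.
Qed.

(** The constant c = 2 n M absorbs the n terms of an entry of the product and
    the factor 2 of [scalar_leM]. *)
Lemma E_term_le b X M k x : mx_bounded_measurable b X ->
  (forall t, 0 <= t <= b -> mx_le (X t) M) -> 0 <= x <= b ->
  mx_le (E_term X k x) ((n%:R * (2 * M) * x) ^+ k / k`!%:R).
Proof.
move=> bX XM; elim: k x => [|k IH] x xb i j.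
  rewrite expr0 divr1 mxE; case: (i == j); first exact: scalar_le1.
  exact: scalar_leW scalar_le0 ler01.
have /andP[x0 xb'] := xb; have b0 := le_trans x0 xb'.
have [br bi] := mx_bounded_measurableM bX (E_term_bounded_measurable k b0 bX) i j.
have le t : 0 <= t <= x -> scalar_le ((X t *m E_term X k t) i j)
    (n%:R * (2 * M) * (n%:R * (2 * M) * t) ^+ k / k`!%:R).
  move=> /andP[t0 tx].
  have tb : 0 <= t <= b by rewrite t0 (le_trans tx xb').
  have := mx_leM (XM t tb) (IH t tb) i j; congr (scalar_le _ _); ring.
have be := bounded_measurable_expn (n%:R * (2 * M)) k b0.
rewrite /= mxE -(running_integral_expn k (n%:R * (2 * M)) x0).
split; [rewrite scalar_re_integral | rewrite scalar_im_integral];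
  by apply: (running_integral_norm_le xb' _ be) => // t /le [].
Qed.

Lemma E_partial_coord X x i j :
  (fun N => E_partial X x N i j) = series (fun k => E_term X k x i j).
Proof. by apply/funext => N; rewrite /E_partial /series /= summxE. Qed.

(** The terms are dominated on [0, b] by (c b)^k / k!, so one exponential tail
    T serves all x. *)
Lemma E_series_uniform b X : 0 <= b -> mx_bounded_measurable b X ->
  exists T : nat -> R, [/\ T @ \oo --> 0, forall N, 0 <= T N &
    forall x, 0 <= x <= b -> E_partial X x @ \oo --> E_series X x /\
      forall N, mx_le (E_series X x - E_partial X x N) (T N)].
Proof.
move=> b0 bX; have [M XM] := mx_bounded_measurable_le bX.
pose u := exp_coeff (n%:R * (2 * `|M|) * b).
have cu : cvgn (series u) := is_cvg_series_exp_coeff _.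
have u0 k : 0 <= u k by rewrite /u exp_coeff_ge0 // !mulr_ge0.
exists (fun N => limn (series u) - series u N); split.
- by rewrite -(subrr (limn (series u))); apply: cvgB => //; exact: cvg_cst.
- move=> N; rewrite subr_ge0; apply: nondecreasing_cvgn_le => //.
  exact: nondecreasing_series.
move=> x xb.
have Eu i j k : scalar_le (E_term X k x i j) (u k).
  have XM' t : 0 <= t <= b -> mx_le (X t) `|M|.
    by move=> tb i' j'; apply: scalar_leW (XM t tb i' j') (ler_norm M).
  apply: (scalar_leW (E_term_le k bX XM' xb i j)).
  rewrite /u /exp_coeff /= ler_wpM2r ?invr_ge0 //.
  by case/andP: xb => x0 xb; rewrite lerXn2r ?nnegrE ?ler_wpM2l // !mulr_ge0.
pose L := \matrix_(i, j) xget 0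
  [set l | series (fun k => E_term X k x i j) @ \oo --> l /\
    forall N, scalar_le (l - series (fun k => E_term X k x i j) N)
      (limn (series u) - series u N)].
have LP i j := xgetPex 0 (scalar_series_dominated (Eu i j) cu).
have cL : E_partial X x @ \oo --> L.
  by apply: mx_cvg => i j; rewrite E_partial_coord mxE; have [] := LP i j.
have EL : E_series X x = L by apply: cvg_lim.
rewrite EL; split=> // N i j.
have [_ /(_ N)] := LP i j.
rewrite /L !mxE -(congr1 (@^~ N) (E_partial_coord X x i j)) /=; exact.
Qed.

Lemma E_series_at0 b X : 0 <= b -> mx_bounded_measurable b X ->
  E_series X 0 = 1%:M.
Proof.
move=> b0 bX; apply: cvg_lim => //.
rewrite -cvg_shiftS /=.
rewrite [X in X @ \oo](_ : _ = fun=> 1%:M); first exact: cvg_cst.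
apply/funext => N; rewrite /E_partial /series /= big_nat_recl //= big1 ?addr0 //.
by move=> k _; exact: E_termS_at0 bX.
Qed.

(** The partial sum of index k + 1 has derivative X times the partial sum of
    index k; both converge uniformly because X is bounded. *)
Lemma E_series_primitive b X : 0 <= b -> mx_bounded_measurable b X ->
  mx_primitive_on b (E_series X) (fun t => X t *m E_series X t).
Proof.
move=> b0 bX; have [M XM] := mx_bounded_measurable_le bX.
have [T [T0 Tge0 ET]] := E_series_uniform b0 bX.
have XM' t : 0 <= t <= b -> mx_le (X t) `|M|.
  by move=> tb i' j'; apply: scalar_leW (XM t tb i' j') (ler_norm M).
apply: (mx_primitive_uniform_limit (U := fun k t => E_partial X t k.+1)
  (V := fun k t => X t *m E_partial X t k)
  (e := fun k => T k.+1 + n%:R * (2 * (`|M| * T k)))).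
- have pS t k : E_partial X t k.+1 = E_partial X t k + E_term X k t.
    by rewrite /E_partial /series /= big_nat_recr.
  elim=> [|k IH].
    apply: (mx_primitive_eq _ _ (mx_primitive_cst b 1%:M)) => t.
      by rewrite pS /E_partial /series /= big_nil add0r.
    by rewrite /E_partial /series /= big_nil mulmx0.
  apply: (mx_primitive_eq _ _ (mx_primitiveD IH (E_term_primitive k b0 bX))) => t.
    by rewrite -pS.
  by rewrite [in RHS]pS mulmxDr.
- move=> k t tb i j; apply: (scalar_leW ((ET t tb).2 k.+1 i j)).
  by rewrite lerDl !mulr_ge0.
- move=> k t tb i j; rewrite -mulmxBr.
  apply: (scalar_leW (mx_leM (XM' t tb) ((ET t tb).2 k) i j)).
  by rewrite lerDr.
- have -> : (0 : R) = 0 + n%:R * (2 * (`|M| * 0)) by rewrite !mulr0 addr0.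
  apply: cvgD; first by rewrite (cvg_shiftS T).
  by do 3! (apply: cvgM; first exact: cvg_cst).
Qed.

End IntegralSeries.

(** * The series F by transposition *)

Section Transposition.
Context {R : realType} {s : scalars} {n : nat}.
Local Notation K := (scalar_field R s).
Implicit Types (b x t : R) (X F G : R -> 'M[K]_n).

Lemma mx_bounded_measurable_tr b X : mx_bounded_measurable b X ->
  mx_bounded_measurable b (fun t => (X t)^T).
Proof. by move=> bX i j; under eq_fun do rewrite mxE; exact: bX. Qed.

Lemma mx_bounded_measurableN b X : mx_bounded_measurable b X ->
  mx_bounded_measurable b (fun t => - X t).
Proof.
by move=> bX i j; under eq_fun do rewrite mxE; exact/scalar_bounded_measurableN/bX.
Qed.

Lemma scalar_bounded_measurable_trace b X : mx_bounded_measurable b X ->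
  scalar_bounded_measurable b (fun t => \tr (X t)).
Proof. by move=> bX; apply: scalar_bounded_measurable_sum => i; exact: bX. Qed.

Lemma E_termS X k x :
  E_term X k.+1 x = mx_integral `[0, x] (fun t => X t *m E_term X k t).
Proof. by []. Qed.

(** Transposition reverses products, which turns one recursion into the
    other. *)
Lemma F_term_tr X k x : F_term X k x = (E_term (fun t => (X t)^T) k x)^T.
Proof.
elim: k x => [|k IH] x; first by rewrite /= trmx1.
apply/matrixP => i j; rewrite /= !mxE; congr (scalar_integral _ _).
by apply/funext => t; rewrite IH -{1}(trmxK (X t)) -trmx_mul mxE.
Qed.

Lemma F_partial_tr X x N :
  F_partial X x N = (E_partial (fun t => (X t)^T) x N)^T.
Proof.
rewrite /F_partial /E_partial /series /= linear_sum /=.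
by apply: eq_bigr => k _; exact: F_term_tr.
Qed.

Lemma E_partial_cvg b X x : mx_bounded_measurable b X -> 0 <= x <= b ->
  E_partial X x @ \oo --> E_series X x.
Proof.
move=> bX xb; have b0 : 0 <= b by case/andP: xb => /le_trans; apply.
by have [T [_ _ /(_ x xb) []]] := E_series_uniform b0 bX.
Qed.

Lemma E_series_coord_cvg b X x i j : mx_bounded_measurable b X -> 0 <= x <= b ->
  series (fun k => E_term X k x i j) @ \oo --> E_series X x i j.
Proof.
move=> bX xb; rewrite -E_partial_coord.
apply: (@cvg_comp _ _ _ (E_partial X x) (fun A : 'M[K]_n => A i j)).
  exact: E_partial_cvg bX xb.
exact: coord_continuous.
Qed.

Lemma F_partial_cvg b X x : mx_bounded_measurable b X -> 0 <= x <= b ->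
  F_partial X x @ \oo --> (E_series (fun t => (X t)^T) x)^T.
Proof.
move=> bX xb; apply: mx_cvg => i j; rewrite mxE.
rewrite (_ : (fun N => _) = fun N => E_partial (fun t => (X t)^T) x N j i).
  rewrite E_partial_coord.
  exact: (E_series_coord_cvg (mx_bounded_measurable_tr bX) xb).
by apply/funext => N; rewrite F_partial_tr mxE.
Qed.

Lemma F_series_tr b X x : mx_bounded_measurable b X -> 0 <= x <= b ->
  F_series X x = (E_series (fun t => (X t)^T) x)^T.
Proof. by move=> bX xb; apply: cvg_lim => //; exact: F_partial_cvg bX xb. Qed.

(** Stated for the transpose of E[X^T], which is F[X] on [0, b]: outside
    this interval the series may diverge. *)
Lemma F_series_primitive b X : 0 <= b -> mx_bounded_measurable b X ->
  mx_primitive_on b (fun x => (E_series (fun t => (X t)^T) x)^T)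
    (fun t => (E_series (fun t => (X t)^T) t)^T *m X t).
Proof.
move=> b0 bX i j.
have := E_series_primitive b0 (mx_bounded_measurable_tr bX) j i.
apply: scalar_primitive_eq => t; first by rewrite mxE.
by rewrite -[in RHS](trmxK (X t)) -trmx_mul [RHS]mxE.
Qed.

End Transposition.

(** * Inverses, uniqueness and Liouville's formula *)

Section Liouville.
Context {R : realType} {s : scalars}.
Local Notation K := (scalar_field R s).
Implicit Types (b x t : R).

(** If G' = - X G, then (F[X] G)' = F[X] X G - F[X] X G = 0. *)
Lemma F_series_mul_solution n b (X G : R -> 'M[K]_n) x :
  mx_bounded_measurable b X -> mx_primitive_on b G (fun t => - X t *m G t) ->
  0 <= x <= b -> F_series X x *m G x = G 0.
Proof.
move=> bX GX xb; have b0 : 0 <= b by case/andP: xb => /le_trans; apply.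
have FG := mx_primitiveM (F_series_primitive b0 bX) GX.
rewrite (F_series_tr bX xb) (mx_primitive0_constant FG _ xb); last first.
  by move=> t _; rewrite mulNmx mulmxN mulmxA addrN.
by rewrite (E_series_at0 b0 (mx_bounded_measurable_tr bX)) trmx1 mul1mx.
Qed.

Lemma F_series_mul_E_series n b (X : R -> 'M[K]_n) x :
  mx_bounded_measurable b X -> 0 <= x <= b ->
  F_series X x *m E_series (fun t => - X t) x = 1%:M.
Proof.
move=> bX xb; have b0 : 0 <= b by case/andP: xb => /le_trans; apply.
have bN := mx_bounded_measurableN bX.
rewrite (F_series_mul_solution bX (E_series_primitive b0 bN) xb).
exact: E_series_at0 b0 bN.
Qed.

(** Both G x and E[X] x are right inverses of F[-X] x. *)
Lemma E_series_unique n b (X G : R -> 'M[K]_n) x :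
  mx_bounded_measurable b X -> mx_primitive_on b G (fun t => X t *m G t) ->
  G 0 = 1%:M -> 0 <= x <= b -> G x = E_series X x.
Proof.
move=> bX GX G0 xb; have bN := mx_bounded_measurableN bX.
have XNN : (fun t => - - X t) = X by apply/funext => t; rewrite opprK.
have FE := F_series_mul_E_series bN xb; rewrite XNN in FE.
have FG : F_series (fun t => - X t) x *m G x = 1%:M.
  rewrite (F_series_mul_solution bN _ xb) //.
  by apply: mx_primitive_eq GX => t //; rewrite opprK.
by rewrite -[G x]mul1mx -(mulmx1C FE) -mulmxA FG mulmx1.
Qed.

Lemma scalar_primitive_expn b (F f : R -> K) k : scalar_primitive_on b F f ->
  scalar_primitive_on b (fun t => F t ^+ k.+1) (fun t => k.+1%:R * (f t * F t ^+ k)).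
Proof.
move=> Ff; elim: k => [|k IH].
  by apply: scalar_primitive_eq Ff => t; rewrite ?expr1 // expr0 mulr1 mul1r.
apply: (scalar_primitive_eq _ _ (scalar_primitiveM Ff IH)) => t.
  by rewrite [RHS]exprS.
by rewrite -[in RHS]natr1 !exprS; ring.
Qed.

Lemma fact_divr_shift (F : numFieldType) (u v w : F) k :
  u * (v / k`!%:R) * w = k.+1%:R * (u * v) * (w / k.+1`!%:R).
Proof.
rewrite factS natrM; field.
by rewrite !pnatr_eq0 -lt0n fact_gt0 addrC natr1 pnatr_eq0.
Qed.

(** The values f t A commute with one another, so the iterated integrals are
    powers: T^(k+1) has derivative (k+1) f T^k, where T is the integral of f from
    0. Taking A = 1 of size 1 gives the scalar exponential, taking f = 1 the
    matrix exponential. *)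
Lemma E_term_scale n b (f : R -> K) (A : 'M[K]_n) k x :
  scalar_bounded_measurable b f -> 0 <= x <= b ->
  E_term (fun t => f t *: A) k x =
  (scalar_integral `[0, x] f ^+ k / k`!%:R) *: A ^+ k.
Proof.
move=> bf; elim: k x => [|k IH] x xb.
  by rewrite !expr0 divr1 scale1r.
have /andP[x0 xb'] := xb; have b0 := le_trans x0 xb'.
apply/matrixP => i j.
set C : K := (A ^+ k.+1) i j / k.+1`!%:R.
have P := scalar_primitiveM
  (scalar_primitive_expn k (scalar_primitive_running_integral b0 bf))
  (scalar_primitive_cst b C).
have := scalar_primitiveE P xb.
rewrite (scalar_running_integral0 b0 bf) expr0n mul0r add0r => E.
rewrite [RHS]mxE mulrAC -mulrA -/C.
transitivity (scalar_running_integral f x ^+ k.+1 * C) => //.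
rewrite E E_termS [LHS]mxE; apply: (scalar_running_integral_eq xb') => t tb.
rewrite (IH t tb) mulr0 addr0.
rewrite -scalemxAl -scalemxAr mulmxE -exprS.
by rewrite scalerA mxE -/(scalar_running_integral f t) fact_divr_shift.
Qed.

Lemma E_series_scale_id b (f : R -> K) x :
  scalar_bounded_measurable b f -> 0 <= x <= b ->
  E_series (fun t => f t *: (1%:M : 'M[K]_1)) x 0 0 =
  scalar_exp (scalar_integral `[0, x] f).
Proof.
move=> bf xb; apply/esym/cvg_lim => //.
have bF : mx_bounded_measurable b (fun t => f t *: (1%:M : 'M[K]_1)).
  move=> i j; under eq_fun do rewrite !mxE.
  by apply: scalar_bounded_measurableM => //; exact: scalar_bounded_measurable_cst.
rewrite [X in series X](_ : _ =
    fun k => E_term (fun t => f t *: (1%:M : 'M[K]_1)) k x 0 0).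
  exact: (E_series_coord_cvg bF xb).
apply/funext => k; by rewrite (E_term_scale _ _ bf xb) expr1n !mxE mulr1.
Qed.

Lemma mx_exp_E_series n (A : 'M[K]_n) : mx_exp A = E_series (fun=> A) 1.
Proof.
rewrite /mx_exp /E_series; congr (limn _); congr series; apply/funext => k.
have x1 : (0 : R) <= (1 : R) <= (1 : R) by rewrite ler01 lexx.
have bf : scalar_bounded_measurable 1 (fun=> 1 : K).
  exact: scalar_bounded_measurable_cst.
rewrite [X in E_term X](_ : _ = fun t => (1 : K) *: A); last first.
  by apply/funext => t; rewrite scale1r.
rewrite (E_term_scale A k bf x1) -/(scalar_running_integral (fun=> 1) 1).
by rewrite scalar_running_integral_cst1 expr1n mul1r.
Qed.

(** Liouville's formula: as a 1 x 1 matrix, the determinant solves the equation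
    with coefficient tr X, because X E adj(E) = det(E) X. *)
Lemma det_E_series n b (X : R -> 'M[K]_n) x :
  mx_bounded_measurable b X -> 0 <= x <= b ->
  \det (E_series X x) = scalar_exp (scalar_integral `[0, x] (fun t => \tr (X t))).
Proof.
move=> bX xb; have b0 : 0 <= b by case/andP: xb => /le_trans; apply.
have btr := scalar_bounded_measurable_trace bX.
rewrite -(E_series_scale_id btr xb).
have bY : mx_bounded_measurable b (fun t => \tr (X t) *: (1%:M : 'M[K]_1)).
  move=> i j; under eq_fun do rewrite !mxE.
  by apply: scalar_bounded_measurableM => //; exact: scalar_bounded_measurable_cst.
pose D t : 'M[K]_1 := (\det (E_series X t))%:M.
have DY : mx_primitive_on b D (fun t => (\tr (X t) *: 1%:M) *m D t).
  move=> i j; have := det_primitive (E_series_primitive b0 bX).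
  apply: scalar_primitive_eq => t; rewrite !ord1 ?mxE //.
  rewrite -mulmxA mul_mx_adj mul_mx_scalar mxtraceZ mulrC.
  by rewrite big_ord1 !mxE /= !mulr1n mulr1.
rewrite -(E_series_unique bY DY _ xb) /D; first by rewrite mxE.
by rewrite (E_series_at0 b0 bX) det1.
Qed.

Lemma trace_mx_integral n b (X : R -> 'M[K]_n) x :
  mx_bounded_measurable b X -> 0 <= x <= b ->
  \tr (mx_integral `[0, x] X) = scalar_integral `[0, x] (fun t => \tr (X t)).
Proof.
move=> bX xb; have b0 : 0 <= b by case/andP: xb => /le_trans; apply.
have P := scalar_primitive_sum (index_enum 'I_n)
  (fun i => scalar_primitive_running_integral b0 (bX i i)).
have := scalar_primitiveE P xb.
rewrite [X in _ = X + _]big1 ?add0r; last first.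
  by move=> i _; exact: scalar_running_integral0 b0 _.
rewrite -[scalar_running_integral _ x]/(scalar_integral `[0, x] (fun t => \tr (X t))).
by move=> <-; apply: eq_bigr => i _; rewrite mxE.
Qed.

Lemma det_mx_exp n (A : 'M[K]_n) : \det (mx_exp A) = scalar_exp (\tr A).
Proof.
have x1 : (0 : R) <= (1 : R) <= (1 : R) by rewrite ler01 lexx.
have bA : mx_bounded_measurable 1 (fun=> A).
  by move=> i j; exact: scalar_bounded_measurable_cst.
rewrite mx_exp_E_series (det_E_series bA x1).
by rewrite -/(scalar_running_integral (fun=> \tr A) 1) scalar_running_integral_cst1.
Qed.

End Liouville.

Theorem theorem3p1 (R : realType) (s : scalars) (n : nat) (b : R)
    (X : R -> 'M[scalar_field R s]_n)
    (X_bounded : mx_bounded_on `[0, b] X)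
    (X_integrable : mx_integrable_on `[0, b] X)
    (x : R) (hx : 0 <= x <= b) :
  [/\ cvgn (E_partial X x) /\ cvgn (F_partial X x),
      [/\ \det (E_series X x) = \det (F_series X x),
          \det (F_series X x) = \det (mx_exp (mx_integral `[0, x] X)),
          \det (mx_exp (mx_integral `[0, x] X)) =
            scalar_exp (scalar_integral `[0, x] (fun t => \tr (X t))) &
          scalar_exp (scalar_integral `[0, x] (fun t => \tr (X t))) =
            scalar_exp (\tr (mx_integral `[0, x] X))] &
      [/\ E_series X x \in unitmx,
          F_series X x \in unitmx,
          F_series X x *m E_series (fun t => - X t) x = 1%:M &
          E_series (fun t => - X t) x *m F_series X x = 1%:M]].
Proof.
have bX : mx_bounded_measurable b X.
  by move=> i j; apply: scalar_bounded_integrable_measurable.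
have FE := F_series_mul_E_series bX hx.
have FE' := F_series_mul_E_series (mx_bounded_measurableN bX) hx.
have XNN : (fun t => - - X t) = X by apply/funext => t; rewrite opprK.
rewrite XNN in FE'.
have detE := det_E_series bX hx.
have detF : \det (F_series X x) =
    scalar_exp (scalar_integral `[0, x] (fun t => \tr (X t))).
  rewrite (F_series_tr bX hx) det_tr.
  rewrite (det_E_series (mx_bounded_measurable_tr bX) hx).
  congr (scalar_exp (scalar_integral _ _)); apply/funext => t.
  exact: mxtrace_tr.
split.
- split; first exact: cvgP (E_partial_cvg bX hx).
  exact: cvgP (F_partial_cvg bX hx).
- by rewrite detE detF det_mx_exp (trace_mx_integral bX hx).
- have [_ uE] := mulmx1_unit FE'; have [uF _] := mulmx1_unit FE.
  by split=> //; exact: mulmx1C.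
Qed.
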